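(* Let $p$ be a prime and let $P$ be a finite $p$-group of odd type such that $\Omega(P)\le Z(P)$. Then $P$ is strongly resistant in saturated fusion systems.
   Context: All groups are finite and maps are written on the right. Fusion systems and saturated fusion systems on finite $p$-groups are understood in the standard sense. Let $\Gamma$ be the nontrivial semidirect product of $\mathbb Z_4$ by $\mathbb Z_4$. A $p$-group $P$ is of odd type if $P$ has no subgroup isomorphic to $Q_8$ and no subgroup isomorphic to $\Gamma$ (so $P$ is always of odd type when $p$ is odd). $\Omega(P)=\langle x\in P\mid x^{p}=1\rangle$. A subgroup $P\le S$ is strongly $\mathcal F$-closed (for a fusion system $\mathcal F$ on $S$) if for all $x\in P$ and all $\phi\in\mathrm{Hom}_{\mathcal F}(\langle x\rangle,S)$ one has $x\phi\in P$. $P\unlhd\mathcal F$ means $\mathcal F=N_{\mathcal F}(P)$, i.e. $P\unlhd S$ and every morphism $\phi:A\to B$ in $\mathcal F$ extends to a morphism $\overline\phi: PA\to PB$ in $\mathcal F$ with $P\overline\phi=P$. A $p$-group $P$ is strongly resistant in saturated fusion systems if $P\unlhd\mathcal F$ whenever $S\ge P$ is a $p$-group and $\mathcal F$ is a saturated fusion system on $S$ such that $P$ is strongly $\mathcal F$-closed. *)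

(* Defs.v *)
From mathcomp Require Import all_boot zmodp all_fingroup all_solvable.

Set Implicit Arguments.
Unset Strict Implicit.
Unset Printing Implicit Defensive.

Import GroupScope.

(* [F A B f] says that the restriction of [f] to [A] is an element of         *)
(* Hom_F(A, B). Values of [f] outside [A] are irrelevant ([fus_ext]).         *)
Record fusion_system (gT : finGroupType) (S : {group gT}) := FusionSystem {
  fus_hom :> {group gT} -> {group gT} -> pred (gT -> gT);
  fus_obj : forall (A B : {group gT}) f,
    fus_hom A B f -> A \subset S /\ B \subset S;
  fus_map : forall (A B : {group gT}) f, fus_hom A B f ->
    [/\ {in A &, {morph f : x y / x * y}}, {in A &, injective f}
      & f @: A \subset B];
  fus_ext : forall (A B : {group gT}) f g,
    {in A, f =1 g} -> fus_hom A B f -> fus_hom A B g;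
  fus_conj : forall (A B : {group gT}) s, A \subset S -> B \subset S -> s \in S ->
    A :^ s \subset B -> fus_hom A B (conjg^~ s);
  fus_comp : forall (A B C : {group gT}) f g,
    fus_hom A B f -> fus_hom B C g -> fus_hom A C (g \o f);
  (* every morphism is an isomorphism onto its image followed by an inclusion *)
  fus_im : forall (A B C : {group gT}) f,
    fus_hom A B f -> f @: A = C -> fus_hom A C f;
  fus_inv : forall (A B C : {group gT}) f g,
    fus_hom A B f -> f @: A = C -> {in A, cancel f g} -> fus_hom C A g
}.

Section Saturation.

Variables (gT : finGroupType) (S : {group gT}) (F : fusion_system S).
Implicit Types A B P Q : {group gT}.

Definition fus_conjugate P Q : Prop := exists2 f, F P Q f & f @: P = Q.

Definition fully_normalized P : Prop :=
  forall Q, fus_conjugate P Q -> #|'N_S(Q)| <= #|'N_S(P)|.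

Definition fully_centralized P : Prop :=
  forall Q, fus_conjugate P Q -> #|'C_S(Q)| <= #|'C_S(P)|.

Definition AutF P : {set {perm gT}} := [set a in Aut P | F P P a].

Definition AutS P : {set {perm gT}} := conj_aut P @* 'N_S(P).

Lemma AutF_group_set P : P \subset S -> group_set (AutF P).
Proof.
move=> sPS; apply/group_setP; split=> [|a b].
  rewrite inE group1 /=.
  apply: (@fus_ext _ _ F _ _ (conjg^~ 1)) => [x _|]; first by rewrite conjg1 perm1.
  by apply: fus_conj; rewrite ?group1 ?conjsg1.
case/setIdP=> Aa Fa /setIdP[Ab Fb]; rewrite inE groupM //=.
by apply: fus_ext (fus_comp Fa Fb) => x _ /=; rewrite permM.
Qed.

(* The elements g of N_S(P) such that the automorphism f x |-> f (x ^ g) of   *)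
(* [f @: P], i.e. c_g transported along f, belongs to Aut_S(f @: P).          *)
Definition Nphi P (f : gT -> gT) : {set gT} :=
  [set g in 'N_S(P) |
     [exists h in 'N_S(f @: P), [forall x in P, f (x ^ g) == f x ^ h]]].

Lemma Nphi_group_set P f : group_set (Nphi P f).
Proof.
apply/group_setP; split=> [|g1 g2].
  rewrite inE group1; apply/exists_inP; exists 1; first exact: group1.
  by apply/forall_inP=> x _; rewrite !conjg1.
case/setIdP=> N1 /exists_inP[h1 H1 /forall_inP E1].
case/setIdP=> N2 /exists_inP[h2 H2 /forall_inP E2].
rewrite inE groupM //; apply/exists_inP; exists (h1 * h2); first exact: groupM.
apply/forall_inP=> x Px; rewrite !conjgM (eqP (E2 _ _)) ?(eqP (E1 _ Px)) //.
by case/setIP: N1 => _ N1; rewrite memJ_norm.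
Qed.
Canonical Nphi_group P f := Group (Nphi_group_set P f).

(* Saturation in the sense of Broto, Levi and Oliver, S being a p-group.      *)
Definition saturated (p : nat) : Prop :=
  (forall P, P \subset S -> fully_normalized P ->
     fully_centralized P /\ p.-Sylow(AutF P) (AutS P))
  /\
  (forall P Q f, F P S f -> f @: P = Q -> fully_centralized Q ->
     exists2 g, F (Nphi_group P f) S g & {in P, g =1 f}).

Definition strongly_closed P : Prop :=
  P \subset S /\
  (forall x f, x \in P -> F <[x]>%G S f -> f x \in P).

Definition fus_normal P : Prop :=
  P <| S /\
  (forall (A B : {group gT}) f, F A B f ->
     exists2 g, F (P <*> A)%G (P <*> B)%G g & {in A, g =1 f} /\ g @: P = P).

End Saturation.

(* [G] is a nontrivial semidirect product of Z_4 by Z_4; it is unique up to   *)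
(* isomorphism because [Aut Z_4] has order 2.                                 *)
Definition isGamma (gT : finGroupType) (G : {group gT}) : Prop :=
  exists K H : {group gT},
    [/\ K ><| H = G, K \isog Zp 4, H \isog Zp 4 & ~~ (H \subset 'C(K))].

Definition odd_type (gT : finGroupType) (P : {group gT}) : Prop :=
  forall Q : {group gT}, Q \subset P -> ~~ (Q \isog 'Q_8) /\ ~ isGamma Q.

(* [P] is regarded as an abstract group: overgroups [S] of [P] are given as   *)
(* groups, in any ambient type, with a subgroup [Q] isomorphic to [P].        *)
Definition strongly_resistant (p : nat) (gT : finGroupType) (P : {group gT})
    : Prop :=
  forall (hT : finGroupType) (S Q : {group hT}) (F : fusion_system S),
    p.-group S -> Q \subset S -> Q \isog P -> saturated F p ->
    strongly_closed F Q -> fus_normal F Q.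

(* Main.v *)
(** An automorphism of p'-order of an odd type p-group D that centralizes
    'Ohm_1(D) is trivial.  On a Thompson critical subgroup one inducts on the
    order of x: if a fixes x ^ p, then u = x^-1 * a x has order dividing p
    (or 4), so that a fixes u and hence u = 1.  For p = 2 the element x inverts
    u; when x has order 4 the absence of Q_8 and Gamma then forces u ^ 2 = 1.

    Let P be strongly closed in F, let R be fully normalized and let K be the
    group of F-automorphisms of R acting trivially on R / (P :&: R) and on
    'Ohm_1(P :&: R).  Then K is a normal p-subgroup of Aut_F(R), so it lies in
    Aut_S(R), and it contains the automorphisms induced by N_P(R) because
    'Ohm_1(P) is central.  Hence every F-automorphism of R extends to N_P(R) R.
    Downward induction on #|A| turns this into an extension to P A of every
    F-morphism defined on A, by factoring it through a fully normalized
    conjugate R of A: both A and its image are sent to R by morphisms defined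
    on their normalizers in S. *)

Require Import Defs.
From mathcomp Require Import all_boot zmodp all_fingroup all_solvable.

Import GroupScope.

(** * Groups of odd type *)

Lemma odd_type_isog {gT hT : finGroupType} {P : {group gT}} {Q : {group hT}} :
  Q \isog P -> odd_type P -> odd_type Q.
Proof.
case/isogP=> f injf imf oddP R sRQ.
have [|nQ8 nGamma] := oddP (f @* R)%G; first by rewrite -imf morphimS.
have isoR (L : {group hT}) : L \subset Q -> L \isog f @* L.
  by move=> sLQ; apply: sub_isog sLQ injf.
split=> [|[K [H [defR K4 H4 ncKH]]]].
  by rewrite (isog_transl _ (isoR R sRQ)).
have /andP[sKR sHR] : (K \subset R) && (H \subset R).
  by case/sdprodP: defR => _ <- _ _; rewrite mulG_subl mulG_subr.
have [sKQ sHQ] := (subset_trans sKR sRQ, subset_trans sHR sRQ).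
apply: nGamma; exists (f @* K)%G, (f @* H)%G; split.
- exact: (injm_sdprod sRQ injf defR).
- by apply: isog_trans K4; rewrite isog_sym isoR.
- by apply: isog_trans H4; rewrite isog_sym isoR.
by rewrite injm_cents.
Qed.

Lemma odd_typeS {gT : finGroupType} {P Q : {group gT}} :
  Q \subset P -> odd_type P -> odd_type Q.
Proof. by move=> sQP oddP R sRQ; apply/oddP/(subset_trans sRQ). Qed.

(** Otherwise a power [w] of [u] has order 4 and is inverted by [x], and [w], [x] generate ['Q_8] if
    [x ^+ 2 = w ^+ 2] and Gamma if not. *)
Lemma odd_type_inverted {gT : finGroupType} {P : {group gT}} {x u : gT} :
  odd_type P -> 2.-group P -> x \in P -> u \in P -> #[x] = 4 ->
  u ^ x = u^-1 -> u ^+ 2 = 1.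
Proof.
move=> oddP pP Px Pu ox ux; apply/eqP; rewrite -order_dvdn; apply/idPn=> u2.
have [k ou] := p_natP (mem_p_elt pP Pu).
have{u2} k_gt1: 1 < k.
  by rewrite ltnNge; apply: contra u2; rewrite ou -{2}[2]expn1; apply: dvdn_exp2l.
case: k => [|[|k]] // in ou k_gt1 *; pose w := u ^+ (2 ^ k).
have ow: #[w] = 4.
  by rewrite orderXdiv ou -(addn2 k) expnD ?mulKn ?expn_gt0 ?dvdn_mulr.
have wx : w ^ x = w^-1 by rewrite conjXg ux expVgn.
have Pw : w \in P by rewrite groupX.
have nwx : <[x]> \subset 'N(<[w]>).
  by rewrite cycle_subG; apply/normP; rewrite -cycleJ wx cycleV.
have x2 : #[x ^+ 2] = 2 by rewrite orderXdiv ox.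
have w2 : #[w ^+ 2] = 2 by rewrite orderXdiv ow.
have notxw : x \notin <[w]>.
  apply/negP => /cycleP[i xi].
  have: w ^ x = w by apply/conjg_fixP/commgP; rewrite xi; apply: commuteX.
  rewrite wx => /eqP; rewrite eq_invg_mul -expg2 -order_dvdn ow.
  by [].
have sWP : <[w]> <*> <[x]> \subset P by rewrite join_subG !cycle_subG Pw.
have [nQ8 nGamma] := oddP (<[w]> <*> <[x]>)%G sWP.
have [xw|nxw] := eqVneq (x ^+ 2) (w ^+ 2).
(* The presentation of ['Q_8] makes the group a quotient of it; since [<[w]>] and [<[x]>] meet in
   order at most 2, its order is at least 8. *)
- case/negP: nQ8; rewrite isogEcard.
  apply/andP; split; last first.
    have ltI4 : #|<[w]> :&: <[x]>| < 4.
      rewrite -ox orderE proper_card // properEneq subsetIr andbT.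
      by apply: contra notxw => /eqP/setIidPr; rewrite cycle_subG.
    have dvdI4 : #|<[w]> :&: <[x]>| %| 4 by rewrite -ox orderE cardSg ?subsetIr.
    have leI2 : #|<[w]> :&: <[x]>| <= 2.
      by move: ltI4 dvdI4; case: #|_| => [|[|[|[|]]]].
    rewrite (@card_quaternion 3) // /= norm_joinEr //.
    rewrite -(leq_pmul2r (cardG_gt0 (<[w]> :&: <[x]>))) -mul_cardG -!orderE ow ox.
    by rewrite (@leq_trans (8 * 2)) // leq_mul2l.
  rewrite (@Grp_quaternion 3) //; apply/existsP; exists (w, x) => /=.
  rewrite !xpair_eqE /= eqxx xw wx !eqxx /=.
  by rewrite -[_ ^+ _]/(w ^+ 4) -ow expg_order eqxx.
have Z4 z : #[z] = 4 -> <[z]> \isog Zp 4.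
  by move=> oz; rewrite isog_sym -oz Zp_isog.
apply: nGamma; exists <[w]>%G, <[x]>%G; split; try exact: Z4.
(* A nontrivial intersection contains an involution [y], the only one in either cyclic group, which
   forces [x ^+ 2 = w ^+ 2]. *)
- rewrite sdprodEY //; apply/eqP/idPn => ntI.
  have [||y /setIP[wy xy] oy] := @Cauchy _ 2 (<[w]> :&: <[x]>)%G; first by [].
    have /p_natP[[|m] oI] : 2.-nat #|<[w]> :&: <[x]>|.
      by apply: pnat_dvd (cardSg (subsetIl _ _)) _; rewrite -orderE ow.
      by case/negP: ntI; rewrite trivg_card1 oI.
    by rewrite oI dvdn_exp.
  have sq z : #[z] = 4 -> y \in <[z]> -> y = z ^+ 2.
    move=> oz /cycleP[i yi]; move: oy; rewrite yi -expg_mod_order oz.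
    have: i %% 4 < 4 by rewrite ltn_mod.
    case: (i %% 4) => [|[|[|[|//]]]] _ //.
    + by rewrite order1.
    + by rewrite expg1 oz.
    by rewrite -[3]/(4.-1) -oz -invg_expg orderV oz.
  by case/eqP: nxw; rewrite -!sq.
apply: contra notxw; rewrite cycle_subG => /centP/(_ w (cycle_id w)) cxw.
have/eqP: w ^ x = w by apply/conjg_fixP/commgP.
by rewrite wx eq_invg_mul -expg2 -order_dvdn ow.
Qed.

(** * Coprime automorphisms of p-groups *)

(** Iteration gives [(a ^+ n) x = x * u ^+ n], and [n = #[a]] yields [u ^+ #[a] = 1]. *)
Lemma fix_coprime_Aut {gT : finGroupType} {G : {group gT}} {a : {perm gT}} {x u : gT} :
  a \in Aut G -> x \in G -> u \in G -> a x = x * u -> a u = u ->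
  coprime #[a] #[u] -> u = 1.
Proof.
move=> Aa Gx Gu ax au co_au.
have Ea n : (a ^+ n) x = x * u ^+ n.
  elim: n => [|n IHn]; first by rewrite perm1 mulg1.
  rewrite expgSr permM IHn -(autmE Aa) morphM ?morphX ?groupX //= autmE au ax.
  by rewrite expgS mulgA.
have := Ea #[a]; rewrite expg_order perm1 => /(canLR (mulKg x)); rewrite mulVg.
move/esym/eqP; rewrite -order_dvdn => dvd_ua; apply/eqP; rewrite -order_eq1.
by rewrite -dvdn1 -(eqP co_au) dvdn_gcd dvd_ua dvdnn.
Qed.

(** The pointwise stabilizer of a critical subgroup in [Aut G] is a p-group. *)
Lemma coprime_Aut_critical {gT : finGroupType} {p : nat} {G K : {group gT}}
    {a : {perm gT}} :
  p.-group G -> critical K G -> a \in Aut G -> p^'.-elt a ->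
  {in K, forall x, a x = x} -> a = 1.
Proof.
move=> pG critK Aa p'a fixK.
have Ca : a \in 'C(K | [Aut G]).
  rewrite astab_ract inE Aa; apply/astabP=> x Kx; exact: fixK.
apply/eqP; rewrite -order_eq1; apply/eqP/(pnat_1 _ p'a).
exact: mem_p_elt (critical_p_stab_Aut critK pG) Ca.
Qed.

Lemma mem_Ohm1 {gT : finGroupType} {p : nat} {G : {group gT}} {x : gT} :
  prime p -> x \in G -> x ^+ p = 1 -> x \in 'Ohm_1(G).
Proof.
move=> p_pr Gx xp; have [->|ntx] := eqVneq x 1; first exact: group1.
rewrite Ohm1Eprime mem_gen // inE Gx.
by rewrite (nt_prime_order p_pr xp).
Qed.

Lemma odd_coprime_Aut_Ohm1 {gT : finGroupType} {p : nat} {G : {group gT}}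
    {a : {perm gT}} :
  prime p -> p.-group G -> odd_type G -> a \in Aut G -> p^'.-elt a ->
  {in 'Ohm_1(G), forall x, a x = x} -> a = 1.
Proof.
move=> p_pr pG oddG Aa p'a fixO1.
have [K critK] := Thompson_critical pG.
have [chK sPhiZ _ _] := critK; have sKG := char_sub chK.
have pK := pgroupS sKG pG.
apply: (coprime_Aut_critical pG critK Aa p'a).
have aX := morphX (autm_morphism Aa).
rewrite /= !autmE in aX.
have aK x : x \in K -> a x \in K.
  move=> Kx; move/charP: chK => [_ /(_ _ (injm_autm Aa) (im_autm Aa)) imK].
  by rewrite -(autmE Aa) -imK mem_morphim // (subsetP sKG).
have fix_of x : x \in G -> a (x^-1 * a x) = x^-1 * a x -> a x = x.
  move=> Gx fixu; have Gu: x^-1 * a x \in G by rewrite groupM ?groupV ?(Aut_closed Aa).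
  have/eqP: x^-1 * a x = 1.
    apply: (fix_coprime_Aut Aa Gx Gu) => //; first by rewrite mulKVg.
    by rewrite coprime_sym (pnat_coprime (mem_p_elt pG Gu)).
  by rewrite -eq_mulVg1 => /eqP.
(* The Frattini subgroup of [K] is central and contains all p-th powers; it also contains the
   commutators, so [K] has class at most 2. *)
have sPhi x : x \in K -> x ^+ p \in 'Z(K).
  move=> Kx; apply: (subsetP sPhiZ); rewrite (Phi_joing pK) mem_gen // inE.
  by rewrite orbC (Mho_p_elt 1) ?(mem_p_elt pK).
(* With [u = x^-1 * a x], the hypothesis reads [(x * u) ^+ 2 = x ^+ 2], that is [u * x * u = x]. *)
have sq_inv x : x \in G -> a (x ^+ 2) = x ^+ 2 -> (x^-1 * a x) ^ x = (x^-1 * a x)^-1.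
  move=> Gx; rewrite aX //; rewrite !expg2 => ax2.
  rewrite conjgE !mulgA invMg invgK; congr (_ * x).
  by apply: (mulIg (a x)); rewrite mulVg -!mulgA ax2 mulKg mulVg.
have fix4 x : p = 2 -> x \in G -> x ^+ 4 = 1 -> a x = x.
  move=> p2 Gx x4; rewrite p2 in p_pr pG.
  have [x2|ntx2] := eqVneq (x ^+ 2) 1; first exact/fixO1/(mem_Ohm1 p_pr).
  have ox : #[x] = 4.
    by apply: (@orderXprime _ 2 2) => //; apply: nt_prime_order; rewrite // -expgM.
  have ax2: a (x ^+ 2) = x ^+ 2.
    by apply/fixO1/(mem_Ohm1 p_pr); rewrite ?groupX // -expgM.
  have Gu: x^-1 * a x \in G by rewrite groupM ?groupV ?(Aut_closed Aa).
  apply/fix_of/fixO1/(mem_Ohm1 p_pr) => //.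
  exact: (odd_type_inverted oddG pG Gx Gu ox (sq_inv _ Gx ax2)).
move=> x Kx; have [n] := ubnP #[x]; elim: n x Kx => // n IHn x Kx le_n.
have Gx := subsetP sKG x Kx.
have [->|ntx] := eqVneq x 1; first by rewrite -(autmE Aa) morph1.
have axp: a (x ^+ p) = x ^+ p.
  apply: IHn; rewrite ?groupX //; apply: leq_trans (_ : #[x] <= n); last by [].
  have [[|k] ox] := p_natP (mem_p_elt pK Kx); first by rewrite -order_eq1 ox in ntx.
  rewrite orderXdiv ox expnS ?dvdn_mulr // mulKn ?prime_gt0 //.
  by rewrite ltn_Pmull ?prime_gt1 ?expn_gt0 ?prime_gt0.
pose u := x^-1 * a x; have Ku: u \in K by rewrite groupM ?groupV ?aK.
have cxu2 : commute x (u ^+ p) by have /centerP[_ /(_ x Kx)] := sPhi u Ku.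
apply: fix_of; rewrite // -/u.
have [p2|p_odd] := even_prime p_pr.
  (* Conjugation by [x] both fixes and inverts [u ^+ 2], so [u ^+ 4 = 1]. *)
  apply: fix4; rewrite ?(subsetP sKG) // (expgM u 2 2).
  rewrite p2 in axp cxu2; have ux2 := sq_inv x Gx axp.
  have: (u ^+ 2) ^ x = u ^+ 2 by apply/conjg_fixP/commgP.
  rewrite conjXg ux2 expVgn => /eqP.
  by rewrite eq_invg_mul -expg2 => /eqP.
apply/fixO1/(mem_Ohm1 p_pr); rewrite ?(subsetP sKG) //.
have K'Z : [~ u, x] \in 'Z(K).
  by apply: (subsetP sPhiZ); rewrite (Phi_joing pK) mem_gen // inE mem_commg.
have /centerP[_ cKR] := K'Z.
have Rp : [~ u, x] ^+ p = 1.
  rewrite -commXg; first exact/eqP/commgP/esym.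
  exact/esym/cKR.
have axE : a x = x * u by rewrite mulKVg.
(* In class 2, [(x * u) ^+ p = x ^+ p * u ^+ p * [~ u, x] ^+ 'C(p, 2)]. The last factor vanishes
   because the odd prime [p] divides the binomial coefficient, so [u ^+ p = 1]. *)
move: axp; rewrite aX // axE expMg_Rmul; first last.
- by apply/esym/cKR.
- by apply/esym/cKR.
have /dvdnP[m ->] : p %| 'C(p, 2).
  rewrite prime_dvd_bin //= ltn_neqAle prime_gt1 // andbT.
  by case: (p) p_odd => [|[|[]]].
rewrite mulnC expgM Rp expg1n mulg1 => axp.
by apply: (mulgI (x ^+ p)); rewrite mulg1.
Qed.

(** * Calculus of morphisms in a fusion system *)

Section Fusion.

Context {gT : finGroupType} {S : {group gT}} {F : fusion_system S}.
Implicit Types A B C P Q R : {group gT}.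

Lemma fus_morphism {A B f} :
  F A B f -> exists2 g : {morphism A >-> gT}, 'injm g & f = g.
Proof.
case/fus_map=> morphf injf _; exists (Morphism morphf) => //.
by apply/injmP.
Qed.

Lemma fus_imset_group {A B f} :
  F A B f -> exists2 C : {group gT}, f @: A = C & C \subset B.
Proof.
move=> Ff; have [_ _ sfAB] := fus_map Ff.
have [g _ def_f] := fus_morphism Ff; exists (g @* A)%G.
  by rewrite def_f /= morphimEdom.
by rewrite /= morphimEdom -def_f.
Qed.

Lemma fus_imset_card {A B f} : F A B f -> #|f @: A| = #|A|.
Proof. by case/fus_map=> _ /card_in_imset-> _. Qed.

Lemma fus_incl {A B} : A \subset B -> B \subset S -> F A B id.
Proof.
move=> sAB sBS; apply: (@fus_ext _ _ F _ _ (conjg^~ 1)) => [x _|].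
  by rewrite conjg1.
by apply: fus_conj; rewrite ?group1 ?conjsg1 ?(subset_trans sAB).
Qed.

Lemma fus_res {A B C f} : C \subset A -> F A B f -> F C B f.
Proof.
move=> sCA Ff; have [sAS _] := fus_obj Ff.
exact: fus_comp (fus_incl sCA sAS) Ff.
Qed.

Lemma fus_cod {A B C f} : F A B f -> f @: A \subset C -> C \subset S -> F A C f.
Proof.
move=> Ff; have [D fA _] := fus_imset_group Ff; rewrite fA => sDC sCS.
exact: fus_comp (fus_im Ff fA) (fus_incl sDC sCS).
Qed.

Lemma fus_inverse {A B C f} : F A B f -> f @: A = C ->
  exists g, [/\ F C A g, {in A, cancel f g}, {in C, cancel g f} & g @: C = A].
Proof.
move=> Ff fA; have [_ injf _] := fus_map Ff.
(* The default 1 is taken only outside [C], where values do not matter. *)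
pose g y := odflt 1 [pick x in A | f x == y].
have fK : {in A, cancel f g}.
  move=> x Ax; rewrite /g; case: pickP => [z /andP[Az /eqP fzx] | /(_ x)] /=.
    exact: injf.
  by rewrite Ax eqxx.
have gK : {in C, cancel g f}.
  by move=> y; rewrite -fA => /imsetP[x Ax ->]; rewrite fK.
exists g; split=> //; first exact: fus_inv Ff fA fK.
by rewrite -fA -imset_comp (eq_in_imset (g := id)) ?imset_id // => x /fK.
Qed.

(** This passes from a function, arbitrary outside [R], to the permutation that is trivial there, so
    that group theory applies to [AutF F R]. *)
Lemma fus_AutF {R f} : F R R f -> exists2 a, a \in AutF F R & {in R, a =1 f}.
Proof.
move=> Ff; have [g injg def_f] := fus_morphism Ff.
have gR : g @* R = R.
  apply/eqP; rewrite eqEcard card_injm // leqnn andbT morphimEdom -def_f.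
  by have [] := fus_map Ff.
exists (aut injg gR) => [|x Rx]; last by rewrite def_f autE.
rewrite inE Aut_aut; apply: fus_ext Ff => x Rx.
by rewrite def_f autE.
Qed.

Lemma AutS_sub {R} : R \subset S -> AutS S R \subset AutF F R.
Proof.
move=> sRS; apply/subsetP=> _ /morphimP[g nRg /setIP[Sg _] ->].
rewrite inE Aut_aut /=.
apply: (@fus_ext _ _ F _ _ (conjg^~ g)) => [x Rx|].
  by rewrite norm_conj_autE.
by apply: fus_conj => //; rewrite (normP nRg).
Qed.

Lemma AutSP {R} {a : {perm gT}} : a \in AutS S R ->
  exists2 h, h \in 'N_S(R) & {in R, forall x, a x = x ^ h}.
Proof.
case/morphimP=> g nRg NSg ->; exists g => // x Rx; exact: norm_conj_autE.
Qed.

(** * Fully normalized conjugates and extension to normalizers *)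

Lemma fully_normalized_conj {P} : P \subset S ->
  exists R f, [/\ F P S f, f @: P = R & fully_normalized F R].
Proof.
move=> sPS.
(* Finite functions make conjugacy a boolean predicate, so a conjugate with largest normalizer can
   be chosen. *)
pose conjP R := [exists f : {ffun gT -> gT}, F P S f && (f @: P == R)].
have conjPP : conjP P.
  apply/existsP; exists (finfun id); apply/andP; split.
    by apply: fus_ext (fus_incl sPS (subxx S)) => x _; rewrite ffunE.
  by rewrite (eq_imset (g := id)) ?imset_id // => x; rewrite ffunE.
case: (arg_maxnP (fun R : {group gT} => #|'N_S(R)|) conjPP) => R.
case/existsP=> f /andP[Ff /eqP fP] maxR; exists R, f; split=> // Q [g Fg gR].
apply: maxR; apply/existsP; exists (finfun (g \o f)).
have Egf: {in P, g \o f =1 finfun (g \o f)} by move=> x _; rewrite ffunE.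
apply/andP; split; last first.
  by rewrite -(eq_in_imset Egf) imset_comp fP gR.
apply: (fus_ext Egf); apply: fus_cod (fus_comp (fus_im Ff fP) Fg) _ _ => //.
by rewrite imset_comp fP gR; case: (fus_obj Fg).
Qed.


(** By Sylow, some [b] in [AutF F R] conjugates the transport of Aut_S(A) along [f] into [AutS S R];
    then [b \o f] extends to the normalizer. The result maps [A] onto [R] but need not agree with
    [f]. *)
Lemma fus_extend_normalizer {p : nat} {A R f} :
  p.-group S -> saturated F p -> fully_normalized F R -> F A S f -> f @: A = R ->
  exists2 g, F 'N_S(A)%G S g & g @: A = R.
Proof.
move=> pS [satN satC] nR Ff fA; have [sAS _] := fus_obj Ff.
have sRS : R \subset S by have [_ _] := fus_map Ff; rewrite fA.
have [cR sylR] := satN R sRS nR.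
have FfR := fus_im Ff fA; have [k [Fk fK kK kR]] := fus_inverse Ff fA.
have fR x : x \in A -> f x \in R by move=> Ax; rewrite -fA imset_f.
have nA g x : g \in 'N_S(A) -> x \in A -> x ^ g \in A.
  by case/setIP=> _ nAg Ax; rewrite memJ_norm.
pose AF := Group (AutF_group_set F sRS).
(* [X] is Aut_S(A) transported along [f]. *)
pose X := [set a in AutF F R |
  [exists g in 'N_S(A), [forall x in A, a (f x) == f (x ^ g)]]].
have XP a : a \in X ->
    exists2 g, g \in 'N_S(A) & {in A, forall x, a (f x) = f (x ^ g)}.
  case/setIdP=> _ /exists_inP[g Ng /forall_inP Eg].
  by exists g => // x /Eg/eqP.
have gX : group_set X.
  apply/group_setP; split=> [|a b Xa Xb].
    rewrite inE (group1 AF); apply/exists_inP; exists 1; first exact: group1.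
    by apply/forall_inP=> x _; rewrite perm1 conjg1.
  have [[g Ng Eg] [h Nh Eh]] := (XP a Xa, XP b Xb).
  have [/setIdP[AFa _] /setIdP[AFb _]] := (Xa, Xb).
  rewrite inE (groupM (G := AF) AFa AFb); apply/exists_inP.
  exists (g * h); first exact: groupM.
  by apply/forall_inP=> x Ax; rewrite permM Eg // Eh ?nA // conjgM.
have sXAF : X \subset AF by apply/subsetP=> a /setIdP[].
(* The order of an element of [X] divides that of an element of [S] inducing it; Cauchy
   concludes. *)
have pX : p.-group (Group gX).
  apply/pgroupP=> q q_pr /(Cauchy q_pr)[a Xa oa].
  have [g Ng Eg] := XP a Xa; have [Sg _] := setIP Ng.
  have /setIdP[/setIdP[Aa _] _] := Xa.
  apply: (pgroupP pS) => //; rewrite -oa.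
  apply: dvdn_trans (order_dvdG Sg); rewrite order_dvdn.
  apply/eqP/(eq_Aut (groupX _ Aa) (group1 _)) => y; rewrite -fA perm1.
  case/imsetP=> x Ax ->; rewrite -[in RHS](conjg1 x) -(expg_order g).
  elim: #[g] => [|n IHn]; first by rewrite perm1 conjg1.
  by rewrite !expgSr permM IHn conjgM Eg // nA // groupX.
have [b AFb sXb] := Sylow_Jsub (G := AF) (P := [group of AutS S R]) (Q := Group gX) sylR sXAF pX.
have [_ Fb] := setIdP AFb.
pose f' := b \o f.
have Ff' : F A R f' by apply: fus_comp FfR Fb.
have f'A : f' @: A = R.
  have oR : #|R| = #|A| by rewrite -fA (fus_imset_card Ff).
  apply/eqP; rewrite eqEcard (fus_imset_card Ff') oR leqnn.
  by have [_ _ ->] := fus_map Ff'.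
have Ff'S : F A S f' by apply: fus_cod Ff' _ _; rewrite ?f'A.
have [g Fg Eg] := satC A R f' Ff'S f'A cR.
exists g; last by rewrite -f'A; apply: eq_in_imset.
(* Conjugation by [h], transported along [f], is an element [a] of [X], and [a ^ b] is conjugation
   by some [z] in ['N_S(R)]; this puts [h] in the domain of [g]. *)
apply: fus_res Fg; apply/subsetP=> h Nh; rewrite inE Nh f'A /=.
have [a AFa Ea] : exists2 a, a \in AutF F R & {in R, a =1 f \o (conjg^~ h \o k)}.
  apply/fus_AutF/(fus_comp _ FfR)/(fus_comp Fk).
  by case/setIP: Nh => Sh nAh; apply: fus_conj; rewrite ?(normP nAh).
have Xa : a \in X.
  rewrite inE AFa; apply/exists_inP; exists h => //.
  by apply/forall_inP=> x Ax; rewrite Ea ?fR //= fK.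
have [|z Nz Ez] := @AutSP R (a ^ b); first by rewrite (subsetP sXb) ?memJ_conjg.
apply/exists_inP; exists z => //; apply/forall_inP=> x Ax.
have Rbf : b (f x) \in R by rewrite -f'A imset_f.
by rewrite /= -Ez // permJ Ea ?fR //= fK.
Qed.

(** * Strongly closed subgroups *)

Context {P : {group gT}}.
Hypothesis clP : strongly_closed F P.

Lemma strongly_closed_mem {A B f x} : F A B f -> x \in A -> x \in P -> f x \in P.
Proof.
move=> Ff Ax Px; apply: (proj2 clP _ f Px).
have [_ sBS] := fus_obj Ff; have [_ _ sfAB] := fus_map Ff.
apply: fus_res (fus_cod Ff (subset_trans sfAB sBS) (subxx S)).
by rewrite cycle_subG.
Qed.

Lemma strongly_closed_im {A B f} : F A B f -> P \subset A -> f @: P = P.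
Proof.
move=> Ff sPA; have Ff' := fus_res sPA Ff.
apply/eqP; rewrite eqEcard (fus_imset_card Ff') leqnn andbT.
by apply/subsetP=> _ /imsetP[x Px ->]; apply: (strongly_closed_mem Ff' Px Px).
Qed.

(** Conjugations by elements of [S] are morphisms of [F], and these map [P] onto itself. *)
Lemma strongly_closed_normal : P <| S.
Proof.
have [sPS _] := clP; rewrite /normal sPS; apply/subsetP=> s Ss; rewrite inE.
have Fs : F S S (conjg^~ s) by apply: fus_conj; rewrite ?conjGid.
by rewrite /conjugate (strongly_closed_im Fs sPS).
Qed.

Lemma strongly_closed_imY {A C f} : F (P <*> A)%G S f -> f @: A = C ->
  f @: (P <*> A) = P <*> C.
Proof.
move=> Ff fA; have [sPAS _] := fus_obj Ff.
have fP := strongly_closed_im Ff (joing_subl _ _).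
have [g injg def_f] := fus_morphism Ff.
rewrite /= in sPAS *; rewrite def_f -(morphimEdom g) /= morphimY ?joing_subl ?joing_subr //.
by rewrite !morphimEsub ?joing_subl ?joing_subr // -def_f fA fP.
Qed.

(** * Extension of morphisms over [P] *)

Lemma fus_extend_norm_closed {p : nat} {R f} :
  prime p -> p.-group S -> saturated F p -> odd_type P -> 'Ohm_1(P) \subset 'Z(P) ->
  fully_normalized F R -> F R R f ->
  exists2 g, F ('N_P(R) <*> R)%G S g & {in R, g =1 f}.
Proof.
move=> p_pr pS [satN satC] oddP OhmZ nR Ff; have [sRS _] := fus_obj Ff.
have [sPS _] := clP; have /andP[_ nPS] := strongly_closed_normal.
have [cR sylR] := satN R sRS nR.
have fR : f @: R = R.
  by apply/eqP; rewrite eqEcard (fus_imset_card Ff) leqnn; case: (fus_map Ff) => _ _ ->.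
pose AF := Group (AutF_group_set F sRS).
pose D := (P :&: R)%G.
have sDP : D \subset P := subsetIl P R; have sDR : D \subset R := subsetIr P R.
have pD : p.-group D := pgroupS (subset_trans sDP sPS) pS.
(* As [a] preserves [R], the first condition is triviality of the action on [R / D]. *)
pose K := [set a in AutF F R | [forall x in R, x^-1 * a x \in P]
                             && [forall x in 'Ohm_1(D), a x == x]].
have KP a : a \in K -> [/\ a \in Aut R, a \in AF,
    {in R, forall x, x^-1 * a x \in P} & {in 'Ohm_1(D), forall x, a x = x}].
  case/setIdP=> AFa /andP[/forall_inP KPa /forall_inP Oa].
  by have /setIdP[Aa _] := AFa; split=> // x /Oa/eqP.
have AF_R a x : a \in AF -> x \in R -> a x \in R.
  by case/setIdP=> Aa _; apply: Aut_closed.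
have AF_D a x : a \in AF -> x \in D -> a x \in D.
  move=> AFa /setIP[Px Rx]; rewrite inE (AF_R a) // andbT.
  by have /setIdP[_ Fa] := AFa; apply: (strongly_closed_mem Fa).
have AF_O a x : a \in AF -> x \in 'Ohm_1(D) -> a x \in 'Ohm_1(D).
  move=> AFa Ox; have /setIdP[Aa _] := AFa.
  have sOD := Ohm_sub 1 D; have Rx := subsetP (subset_trans sOD sDR) x Ox.
  rewrite -(autmE Aa); have: autm Aa x \in autm Aa @* 'Ohm_1(D).
    exact: mem_morphim.
  rewrite injm_Ohm ?injm_autm //; apply/subsetP/OhmS.
  apply/subsetP=> _ /morphimP[y Ry Dy ->]; rewrite /= autmE.
  exact: AF_D.
have gK : group_set K.
  apply/group_setP; split=> [|a b Ka Kb].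
    rewrite inE (group1 AF) /=; apply/andP; split; apply/forall_inP=> x _.
      by rewrite perm1 mulVg.
    by rewrite perm1.
  have [[_ AFa Pa Oa] [_ AFb Pb Ob]] := (KP a Ka, KP b Kb).
  rewrite inE (groupM (G := AF) AFa AFb) /=; apply/andP; split; apply/forall_inP=> x Rx.
    rewrite permM -(mulKVg (a x) (b _)) mulgA groupM ?Pa ?Pb //.
    exact: AF_R.
  by rewrite permM Oa // Ob.
(* By strong closure, F-automorphisms of [R] preserve membership in [P], hence also [D] and
   ['Ohm_1(D)], so both conditions survive conjugation. *)
have nKAF : AF \subset 'N(K).
  apply/subsetP=> b AFb; rewrite inE; apply/subsetP=> _ /imsetP[a Ka ->].
  have [_ AFa Pa Oa] := KP a Ka.
  have Eab x : (a ^ b) x = b (a (b^-1 x)).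
    by rewrite -{1}(permKV b x) permJ.
  have AFb' : b^-1 \in AF := groupVr (G := AF) AFb.
  rewrite inE (groupJ (G := AF) AFa AFb) /=; apply/andP; split; apply/forall_inP=> x Rx.
    have /setIdP[Ab Fb] := AFb; have Ry := AF_R _ _ AFb' Rx.
    rewrite Eab -{1}(permKV b x) -!(autmE Ab) -morphV // -morphM ?groupV ?AF_R //=.
    rewrite autmE; apply: (strongly_closed_mem Fb); last exact: Pa.
    by rewrite groupM ?groupV ?AF_R.
  by rewrite Eab Oa ?permKV // AF_O.
(* An element of prime order other than [p] is trivial on [D] by [odd_coprime_Aut_Ohm1]; being
   trivial on [R / D] too, it is trivial by coprimality. *)
have pK : p.-group (Group gK).
  apply/pgroupP=> q q_pr /(Cauchy q_pr)[a Ka oa].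
  have [Aa AFa Pa Oa] := KP a Ka.
  apply: contraLR (q_pr) => p'q; suffices a1 : a = 1 by rewrite -oa a1 order1.
  have p'a : p^'.-elt a by rewrite /p_elt oa pnatE.
  have Na : a \in 'N(D | 'P).
    by rewrite !inE; apply/subsetP=> x Dx; rewrite inE /= /aperm AF_D.
  have fixD : {in D, forall x, a x = x}.
    move=> x Dx; rewrite -(restr_permE Na Dx).
    suffices ->: restr_perm D a = 1 by rewrite perm1.
    apply: (odd_coprime_Aut_Ohm1 p_pr pD (odd_typeS sDP oddP)).
    - exact: (Aut_restr_perm sDR Aa).
    - exact: morph_p_elt.
    move=> y Oy; rewrite (restr_permE Na) ?Oa //.
    exact: subsetP (Ohm_sub 1 D) y Oy.
  apply: (eq_Aut Aa (group1 _)) => x Rx; rewrite perm1.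
  have Du : x^-1 * a x \in D by rewrite inE Pa // groupM ?groupV ?AF_R.
  have/eqP: x^-1 * a x = 1.
    apply: (fix_coprime_Aut Aa Rx (subsetP sDR _ Du)).
    - by rewrite mulKVg.
    - exact: fixD.
    by rewrite coprime_sym (pnat_coprime (mem_p_elt pD Du)).
  by rewrite -eq_mulVg1 => /eqP.
(* A normal p-subgroup lies in ['O_p(AF)], hence in the Sylow subgroup [AutS S R]. *)
have sKS : K \subset AutS S R.
  have nKAF' : Group gK <| AF.
    by rewrite /normal nKAF andbT; apply/subsetP=> a /KP[].
  have sKO : Group gK \subset 'O_p(AF) by apply: pcore_max.
  apply: subset_trans sKO _.
  exact: (@pcore_sub_Hall p _ AF [group of AutS S R] sylR).
have [b AFb Eb] := fus_AutF Ff.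
have FfS : F R S f by apply: fus_cod Ff _ _; rewrite ?fR.
have [g Fg Eg] := satC R R f FfS fR cR.
exists g => //; apply: fus_res Fg; rewrite /= join_subG; apply/andP; split.
  apply/subsetP=> h /setIP[Ph nRh]; have Sh := subsetP sPS h Ph.
  have NSh : h \in 'N_S(R) by apply/setIP.
  (* Commutators with [h] lie in [P] since [P] is normal in [S], and [h] centralizes ['Ohm_1(P)],
     which contains ['Ohm_1(D)]. *)
  have Kh : conj_aut R h \in K.
    rewrite inE (subsetP (AutS_sub sRS)) ?mem_morphim //=.
    apply/andP; split; apply/forall_inP=> x Rx.
      rewrite norm_conj_autE // -/(commg x h) -groupV invg_comm commgEl groupM ?groupV //.
      by rewrite memJ_norm // (subsetP nPS) ?(subsetP sRS).
    have [Px Rx'] := setIP (subsetP (Ohm_sub 1 D) x Rx).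
    rewrite norm_conj_autE //; apply/eqP/conjg_fixP/commgP.
    have /centerP[_] := subsetP OhmZ x (subsetP (OhmS 1 sDP) x Rx).
    exact.
  (* Normality of [K] keeps the transport along [f] inside [AutS S R]. *)
  have [|z Nz Ez] := @AutSP R (conj_aut R h ^ b).
    by rewrite (subsetP sKS) // memJ_norm // (subsetP nKAF).
  rewrite inE NSh fR; apply/exists_inP; exists z => //.
  apply/forall_inP=> x Rx; rewrite -Eb ?memJ_norm // -(Eb x) // -Ez ?AF_R //.
  by rewrite permJ norm_conj_autE.
have sRN : R \subset 'N_S(R) by rewrite subsetI sRS normG.
have fRR x : x \in R -> f x \in R by move=> Rx; rewrite -fR imset_f.
apply/subsetP=> h Rh; rewrite inE fR (subsetP sRN) //.
apply/exists_inP; exists (f h); first by rewrite (subsetP sRN) ?fRR.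
apply/forall_inP=> x Rx; apply/eqP; have [g' _ def_f] := fus_morphism Ff.
by rewrite def_f morphJ.
Qed.

Lemma fus_extend_closed {p : nat} {A f} :
  prime p -> p.-group S -> saturated F p -> odd_type P -> 'Ohm_1(P) \subset 'Z(P) ->
  F A S f -> exists2 g, F (P <*> A)%G S g & {in A, g =1 f}.
Proof.
move=> p_pr pS satF oddP OhmZ.
have [sPS _] := clP; have /andP[_ nPS] := strongly_closed_normal.
have [n] := ubnP (#|S| - #|A|); elim: n => // n IHn in A f *.
rewrite ltnS => le_n Ff; have [sAS _] := fus_obj Ff.
have [sPA | nsPA] := boolP (P \subset A).
  have -> : (P <*> A)%G = A by apply/val_inj/joing_idPr.
  by exists f.
(* Properness makes the normalizers of these subgroups strictly larger, which is what lets the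
   induction apply. *)
have neqS B : #|B| = #|A| -> B \subset S -> B \proper S.
  move=> oB sBS; rewrite properEcard sBS oB proper_card // properE sAS.
  by apply: contra nsPA; apply: subset_trans.
have IH B C h : #|A| < #|B| -> F B S h -> C \subset B ->
    exists2 g, F (P <*> C)%G S g & {in C, g =1 h}.
  move=> ltAB Fh sCB; have [sBS _] := fus_obj Fh.
  have [|g Fg Eg] := IHn B h _ Fh.
    apply: leq_trans le_n; rewrite ltn_sub2l // (leq_trans ltAB) //.
    exact: subset_leq_card.
  exists g => [|x Cx]; last by rewrite Eg ?(subsetP sCB).
  by apply: fus_res Fg; rewrite genS // setUS.
(* Agreement with [h] is given up in order to extend to ['N_S(B)]; the automorphism of [R] built
   below repairs the loss. *)
have IHnorm B R h : #|B| = #|A| -> fully_normalized F R -> F B S h -> h @: B = R ->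
    exists2 g, F (P <*> B)%G S g & g @: B = R.
  move=> oB nR Fh hB; have [sBS _] := fus_obj Fh.
  have [g Fg gB] := fus_extend_normalizer pS satF nR Fh hB.
  have sBN : B \subset 'N_S(B) by rewrite subsetI sBS normG.
  have [|g' Fg' Eg'] := IH 'N_S(B)%G B g _ Fg sBN.
    by rewrite -oB proper_card // (nilpotent_proper_norm (pgroup_nil pS)) ?neqS.
  by exists g' => //; rewrite -gB; apply: eq_in_imset.
have [C fA sCS] := fus_imset_group Ff.
have oC : #|C| = #|A| by rewrite -fA (fus_imset_card Ff).
have [R [chi [Fchi chiA nR]]] := fully_normalized_conj sAS.
have sRS : R \subset S by have [_ _] := fus_map Fchi; rewrite chiA.
have [h1 Fh1 h1A] := IHnorm A R chi erefl nR Fchi chiA.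
have FfC := fus_im Ff fA.
have [k [Fk fK kK kC]] := fus_inverse FfC fA.
have [h2 Fh2 h2C] : exists2 h2, F (P <*> C)%G S h2 & h2 @: C = R.
  apply: (IHnorm C R (chi \o k)) => //; first exact: fus_comp Fk Fchi.
  by rewrite imset_comp kC.
have Fh1R : F (P <*> A)%G (P <*> R)%G h1.
  exact: fus_im Fh1 (strongly_closed_imY Fh1 h1A).
have h2Y : h2 @: (P <*> C)%G = (P <*> R)%G by exact: strongly_closed_imY Fh2 h2C.
have [k2 [Fk2 h2K k2K k2R]] := fus_inverse Fh2 h2Y.
have Fh1A : F A R h1 by apply: fus_im h1A; apply: fus_res Fh1; apply: joing_subr.
have [k1 [Fk1 h1K k1K k1R]] := fus_inverse Fh1A h1A.
have Fh2C : F C R h2 by apply: fus_im h2C; apply: fus_res Fh2; apply: joing_subr.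
(* This is [f] read on [R] through [h1] on the source and [h2] on the image. *)
have Fb : F R R (h2 \o (f \o k1)) by apply: fus_comp (fus_comp Fk1 FfC) Fh2C.
have [g3 Fg3 Eg3] := fus_extend_norm_closed p_pr pS satF oddP OhmZ nR Fb.
have oR : #|R| = #|A| by rewrite -h1A (fus_imset_card Fh1A).
have nsPR : ~~ (P \subset R).
  apply: contra nsPA => sPR; have := strongly_closed_im Fk1 sPR.
  by move=> <-; rewrite -k1R; apply: imsetS.
(* If ['N_P(R)] lay in [R], then [R] would be self-normalizing in the p-group [P <*> R], hence equal
   to it, although [P] is not contained in [R]. *)
have ltRN : R \proper 'N_P(R) <*> R.
  rewrite properE joing_subr join_subG subxx andbT; apply: contra nsPR => sNR.
  have nilY : nilpotent (P <*> R).
    by apply: pgroup_nil (pgroupS _ pS); rewrite join_subG sPS.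
  apply: subset_trans (joing_subl P R) _.
  rewrite (nilpotent_sub_norm nilY (joing_subr P R)) //.
  have nPR := subset_trans sRS nPS.
  rewrite /= norm_joinEr //; apply/subsetP=> _ /setIP[/mulsgP[x y Px Ry ->] nxy].
  rewrite groupMr // (subsetP sNR) // in_setI Px.
  by rewrite -(groupMr x (subsetP (normG R) y Ry)).
have [|g4 Fg4 Eg4] := IH _ R g3 _ Fg3 (joing_subr _ _).
  by rewrite -oR proper_card.
have g4R : g4 @: R = R.
  have Eg : {in R, g4 =1 h2 \o (f \o k1)} by move=> x Rx; rewrite Eg4 ?Eg3.
  by rewrite (eq_in_imset Eg) (imset_comp h2) (imset_comp f) k1R fA h2C.
have Fg4R : F (P <*> R)%G (P <*> R)%G g4.
  exact: fus_im Fg4 (strongly_closed_imY Fg4 g4R).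
have sPCS : (P <*> C) \subset S by rewrite join_subG sPS.
(* All three factors are defined on joins with [P]; on [A] the maps [h1] and [h2] cancel with their
   inverses and leave [f]. *)
exists (k2 \o (g4 \o h1)).
  apply: fus_cod (fus_comp (fus_comp Fh1R Fg4R) Fk2) _ _ => //.
  by have [_ _ sim] := fus_map (fus_comp (fus_comp Fh1R Fg4R) Fk2); apply: subset_trans sim _.
move=> x Ax /=; have Rx : h1 x \in R by rewrite -h1A imset_f.
rewrite Eg4 // Eg3 //= h1K // h2K //.
by rewrite (subsetP (joing_subr P C)) // -fA imset_f.
Qed.

End Fusion.

(** * Transfer to a copy of [P] in [S], and normality in [F] *)

Theorem corollary5 (p : nat) (gT : finGroupType) (P : {group gT})
  (p_prime : prime p) (pP : p.-group P) (oddP : odd_type P)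
  (OhmZ : 'Ohm_1(P) \subset 'Z(P)) :
  strongly_resistant p P.
Proof.
move=> hT S Q F pS sQS isoQP satF clQ.
have oddQ := odd_type_isog isoQP oddP.
have OhmZQ : 'Ohm_1(Q) \subset 'Z(Q).
  have [f injf <-] : exists2 f : {morphism P >-> hT}, 'injm f & f @* P = Q.
    by move: isoQP; rewrite isog_sym => /isogP[f injf fP]; exists f.
  by rewrite -injm_Ohm // -injm_center // morphimS.
split=> [|A B f Ff]; first exact: (strongly_closed_normal clQ).
have [sAS sBS] := fus_obj Ff; have [_ _ sfAB] := fus_map Ff.
have FfS : F A S f by apply: fus_cod Ff (subset_trans sfAB sBS) _.
have [g Fg Eg] := fus_extend_closed clQ p_prime pS satF oddQ OhmZQ FfS.
exists g; last by split=> //; apply: (strongly_closed_im clQ Fg); apply: joing_subl.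
have [C fA _] := fus_imset_group Ff.
have gA : g @: A = C by rewrite -fA; apply: eq_in_imset.
(* The codomain shrinks from [S] to [Q <*> B] because [g] maps [Q <*> A] onto [Q <*> C]. *)
apply: (fus_cod Fg); last by rewrite join_subG sQS.
by rewrite (strongly_closed_imY clQ Fg gA) genS // setUS // -fA.
Qed.
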